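(* Let $\ell\ge 5$ be a prime number, $N>0$ an integer prime to $\ell$, and $k>2$ an integer. Let $f\in S_{k}(\Gamma_{1}(N))$ be a normalized eigenform with nebentypus character $\varepsilon$ and let $\lambda$ be a prime of $K_f$ lying over $\ell$. Suppose the representation $\rho_{f,\ell}=\rho_{f,\lambda}$ is irreducible. Let $i$ be an integer with $0\le i \le \ell-1$ such that, with $$H=\{x \bmod N\ell \ :\ 0<x<N\ell,\ \gcd(x,N\ell)=1,\ \varepsilon(x)\,x^{k-2-2i} \equiv 1 \bmod \lambda \}\subseteq (\mathbb{Z}/N\ell\mathbb{Z})^{*},\qquad \Gamma_H=\Gamma_H(N\ell),$$ there exist a normalized eigenform $f_2\in S_2(\Gamma_H)$ and a prime $\lambda_2$ of $K_{f_2}$ over $\ell$ with $\rho_{f,\lambda}\cong\rho_{f_2,\lambda_2}\otimes\chi_\ell^i$. Suppose $\ell \nmid \phi(N)$ and $\ell-1$ divides $k-2-2i$. Then $\Gamma_H=\Gamma_{0}(N\ell)$ if and only if $f\in S_{k}(\Gamma_{0}(N))$.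
   Context: $\phi$ is Euler's totient function. For a positive integer $n$ and a subgroup $H$ of $(\mathbb{Z}/n\mathbb{Z})^{*}$, $\Gamma_H(n)$ is the group of matrices $\begin{pmatrix} a&b\\c&d\end{pmatrix}\in SL(2,\mathbb{Z})$ with $c\equiv 0 \pmod n$ and $d \bmod n\in H$; $\Gamma_0(n)$ and $\Gamma_1(n)$ are the cases $H=(\mathbb{Z}/n\mathbb{Z})^*$ and $H=\{1\}$. $S_k(\Gamma)$ is the space of cusp forms of weight $k$ on $\Gamma$. A normalized eigenform $g=\sum_{m>0}a_m(g)q^m$ is an eigenform for the Hecke operators (including diamond operators) with $a_1(g)=1$; $K_g$ is the number field generated by all the coefficients $a_m(g)$. For a normalized eigenform $g\in S_k(\Gamma_1(n))$ with nebentypus $\varepsilon$ and a prime $\mu$ of $K_g$ over $\ell$, with residue field embedded in $\overline{\mathbb{F}}_\ell$, $\rho_{g,\mu}:\mathrm{Gal}(\overline{\mathbb{Q}}/\mathbb{Q})\to GL_2(\overline{\mathbb{F}}_\ell)$ is the unique (up to isomorphism) continuous semisimple representation, unramified outside $n\ell$, such that for all primes $p\nmid n\ell$ the characteristic polynomial of $\rho_{g,\mu}(\mathrm{Frob}_p)$ is $x^2-a_p(g)x+\varepsilon(p)p^{k-1} \bmod \mu$; isomorphisms between representations attached to different forms are understood for suitable embeddings of residue fields. $\chi_\ell$ is the mod $\ell$ cyclotomic character. Negative powers of $x$ are taken modulo $\ell$. *)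

(* Defs.v *)
From HB Require Import structures.
From mathcomp Require Import all_boot all_order all_algebra all_field.
From mathcomp Require Import complex.
From mathcomp Require Import all_classical all_reals all_analysis.

Set Implicit Arguments.
Unset Strict Implicit.
Unset Printing Implicit Defensive.

Import Order.TTheory GRing.Theory Num.Theory.
Import numFieldNormedType.Exports.

Local Open Scope classical_set_scope.
Local Open Scope ring_scope.

(* Naming R[i] at type numClosedFieldType gives access to the topology that
   MathComp-Analysis puts on every numFieldType; R[i] itself has none. *)
Definition Cx (R : realType) : numClosedFieldType := R[i].

Definition cexp (R : realType) (z : Cx R) : Cx R :=
  Complex (expR (complex.Re z) * cos (complex.Im z))
          (expR (complex.Re z) * sin (complex.Im z)).

Definition two_pi_i (R : realType) : Cx R := Complex 0 (2 * pi : R).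

Definition in_uhp (R : realType) (z : Cx R) : Prop := 0 < complex.Im z.

Definition mat2 (a b c d : int) : 'M[int]_2 :=
  \matrix_(i, j) if i == 0 then (if j == 0 then a else b)
                 else (if j == 0 then c else d).

Definition SL2Z : set 'M[int]_2 := [set g | \det g = 1].

(* Classes modulo n are represented by their residues in [0, n[ (the ring 'Z_n
   would be wrong for n = 1). *)
Definition unit_residues (n : nat) : set int :=
  [set x | 0 <= x < n%:Z /\ coprimez x n%:Z].

(* For H a set of residues modulo n that are prime to n. *)
Definition GammaH (n : nat) (H : set int) : set 'M[int]_2 :=
  [set g | [/\ SL2Z g, (n%:Z %| g 1%R 0%R)%Z & H (g 1%R 1%R %% n%:Z)%Z]].

Definition Gamma0 (n : nat) : set 'M[int]_2 := GammaH n (unit_residues n).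

Definition Gamma1 (n : nat) : set 'M[int]_2 := GammaH n [set (1 %% n%:Z)%Z].

(* A form is a function on all of C, of which only the restriction to the upper
   half plane matters. The action of GL_2^+ is normalized by det^(k-1), as is
   usual for Hecke operators. *)
Definition slash (R : realType) (k : nat) (g : 'M[int]_2) (f : Cx R -> Cx R)
    (z : Cx R) : Cx R :=
  let j := (g 1 0)%:~R * z + (g 1 1)%:~R in
  (\det g)%:~R ^ (k%:Z - 1) * j ^- k * f (((g 0 0)%:~R * z + (g 0 1)%:~R) / j).

(* f(z) = sum_(m >= 0) a_m exp(2 pi i m z / h) *)
Definition fourier_expansion (R : realType) (h : nat) (a : nat -> Cx R)
    (f : Cx R -> Cx R) : Prop :=
  forall z : Cx R, in_uhp z ->
    series (fun m => a m * cexp (two_pi_i R * z / h%:R) ^+ m : Cx R)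
      @ \oo --> f z.

Definition cusp_form (R : realType) (k : nat) (G : set 'M[int]_2)
    (f : Cx R -> Cx R) : Prop :=
  [/\ forall z : Cx R, in_uhp z -> derivable f z 1,
      forall g, G g -> forall z : Cx R, in_uhp z -> slash k g f z = f z
    & forall g, SL2Z g -> exists h : nat, exists a : nat -> Cx R,
        [/\ (0 < h)%N, a 0%N = 0 & fourier_expansion h a (slash k g f)]].

Definition qcoef (R : realType) (f : Cx R -> Cx R) : nat -> Cx R :=
  xget (fun=> 0) [set a | fourier_expansion 1 a f].

Definition diamond (R : realType) (N k : nat) (d : int) (f : Cx R -> Cx R) :
    Cx R -> Cx R :=
  slash k (xget 1%:M [set g | Gamma0 N g /\ (g 1%R 1%R = d %[mod N%:Z])%Z]) f.

(* T_n f = sum of (<a> f)|_k [a b; 0 n/a] over a | n with (a, N) = 1 and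
   0 <= b < n/a; for n = p prime this is the usual pair of formulas for the
   cases p | N and p not dividing N. *)
Definition hecke (R : realType) (N k n : nat) (f : Cx R -> Cx R)
    (z : Cx R) : Cx R :=
  \sum_(a <- divisors n | coprime a N) \sum_(b < (n %/ a)%N)
    slash k (mat2 a%:Z b%:Z 0 (n %/ a)%N%:Z) (diamond N k a%:Z f) z.

Definition eigenvector (R : realType) (T : (Cx R -> Cx R) -> Cx R -> Cx R)
    (f : Cx R -> Cx R) : Prop :=
  exists c : Cx R, forall z : Cx R, in_uhp z -> T f z = c * f z.

Definition normalized_eigenform (R : realType) (N k : nat)
    (f : Cx R -> Cx R) : Prop :=
  [/\ cusp_form k (Gamma1 N) f,
      exists2 z : Cx R, in_uhp z & f z != 0,
      forall n : nat, (0 < n)%N -> eigenvector (hecke N k n) f,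
      forall d : int, coprimez d N%:Z -> eigenvector (diamond N k d) f
    & qcoef f 1 = 1].

Definition dirichlet_character (R : realType) (N : nat) (eps : int -> Cx R) :
    Prop :=
  [/\ eps 1 = 1,
      forall x y, eps (x * y) = eps x * eps y,
      forall x y, (x = y %[mod N%:Z])%Z -> eps x = eps y
    & forall x, eps x != 0 <-> coprimez x N%:Z].

Definition nebentypus (R : realType) (N k : nat) (f : Cx R -> Cx R)
    (eps : int -> Cx R) : Prop :=
  dirichlet_character N eps /\
  forall g, Gamma0 N g ->
    forall z : Cx R, in_uhp z -> slash k g f z = eps (g 1 1) * f z.

Definition coef_field (R : realType) (f : Cx R -> Cx R) : set (Cx R) :=
  [set x | forall S : {pred Cx R}, divring_closed S ->
     (forall m : nat, qcoef f m \in S) -> x \in S].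

Definition integers_of (F : fieldType) (K : set F) : set F :=
  [set x | K x /\ integralOver (intr : int -> F) x].

Definition prime_over (F : fieldType) (O P : set F) (p : nat) : Prop :=
  [/\ P `<=` O /\ P p%:R,
      forall x y, P x -> P y -> P (x + y),
      forall x y, O x -> P y -> P (x * y),
      ~ P 1
    & forall x y, O x -> O y -> P (x * y) -> P x \/ P y].

(* r restricted to O is a ring morphism with kernel P, i.e. an embedding of the
   residue field O / P into E. *)
Definition residue_embedding (F E : fieldType) (O P : set F) (r : F -> E) :
    Prop :=
  [/\ r 1 = 1,
      forall x y, O x -> O y -> r (x + y) = r x + r y,
      forall x y, O x -> O y -> r (x * y) = r x * r y
    & forall x, O x -> (r x = 0 <-> P x)].

(* Ring endomorphisms of algC are automorphisms (algC_autK, algC_invautK). *)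
Definition GalQ : Type := {rmorphism algC -> algC}.

Definition integers_Qbar : set algC := [set x | x \in Aint].

Definition inertia (P : set algC) (s : GalQ) : Prop :=
  forall x, integers_Qbar x -> P (s x - x).

(* Arithmetic Frobenius. This condition and the previous one imply that s
   stabilizes P. *)
Definition frobenius (p : nat) (P : set algC) (s : GalQ) : Prop :=
  forall x, integers_Qbar x -> P (s x - x ^+ p).

Definition representation (E : fieldType) (rho : GalQ -> 'M[E]_2) : Prop :=
  rho (idfun : GalQ) = 1%:M /\
  forall s t : GalQ, rho (s \o t : GalQ) = rho s *m rho t.

(* Krull topology on the source, discrete topology on the target. *)
Definition continuous_rep (E : fieldType) (rho : GalQ -> 'M[E]_2) : Prop :=
  forall s : GalQ, exists A : seq algC,
    forall t : GalQ, (forall x, x \in A -> t x = s x) -> rho t = rho s.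

Definition stable_subspace (E : fieldType) (rho : GalQ -> 'M[E]_2)
    (U : {vspace 'cV[E]_2}) : Prop :=
  forall (s : GalQ) v, v \in U -> rho s *m v \in U.

Definition irreducible_rep (E : fieldType) (rho : GalQ -> 'M[E]_2) : Prop :=
  forall U, stable_subspace rho U -> U = 0%VS \/ U = fullv.

Definition semisimple_rep (E : fieldType) (rho : GalQ -> 'M[E]_2) : Prop :=
  forall U, stable_subspace rho U ->
    exists W, [/\ stable_subspace rho W, (U + W)%VS = fullv
                & (U :&: W)%VS = 0%VS].

Definition unramified_at (E : fieldType) (rho : GalQ -> 'M[E]_2) (p : nat) :
    Prop :=
  forall P, prime_over integers_Qbar P p ->
    forall s, inertia P s -> rho s = 1%:M.

Definition iso_rep (E : fieldType) (rho rho' : GalQ -> 'M[E]_2) : Prop :=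
  exists2 M : 'M[E]_2, M \in unitmx &
    forall s : GalQ, rho s = M *m rho' s *m invmx M.

(* The element c of F_l with s z = z ^ c for z an l-th root of unity. *)
Definition cyclotomic_character (l : nat) (s : GalQ) : 'F_l :=
  odflt 0 [pick c : 'F_l |
    `[< forall z : algC, z ^+ l = 1 -> s z = z ^+ (c : nat) >]].

Definition twist (E : fieldType) (l : nat) (emb : 'F_l -> E) (i : nat)
    (rho : GalQ -> 'M[E]_2) : GalQ -> 'M[E]_2 :=
  fun s => emb (cyclotomic_character l s) ^+ i *: rho s.

(* rho is rho_(g, P), for g of level n, weight k and nebentypus eps, when the
   residue field of P is embedded in E by r. *)
Definition attached_rep (R : realType) (E : fieldType) (n k l : nat)
    (g : Cx R -> Cx R) (eps : int -> Cx R) (P : set (Cx R)) (r : Cx R -> E)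
    (rho : GalQ -> 'M[E]_2) : Prop :=
  [/\ residue_embedding (integers_of (coef_field g)) P r,
      [/\ representation rho, continuous_rep rho & semisimple_rep rho]
    & forall p : nat, prime p -> ~~ (p %| n * l)%N ->
        unramified_at rho p /\
        forall Q s, prime_over integers_Qbar Q p -> frobenius p Q s ->
          char_poly (rho s) =
            'X^2 - (r (qcoef g p))%:P * 'X
              + (r (eps p%:Z * p%:R ^+ k.-1))%:P].

(* The classes x mod N l such that eps(x) x^e = 1 mod P. The power is computed
   in F_l, so that it makes sense for e < 0, and then lifted to [0, l[; the
   choice of the lift is irrelevant modulo a prime above l. *)
Definition character_kernel (R : realType) (N l : nat) (eps : int -> Cx R)
    (P : set (Cx R)) (e : int) : set int :=
  [set x | [/\ 0 < x < (N * l)%N%:Z, coprimez x (N * l)%N%:Z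
     & let y : 'F_l := x%:~R ^ e in P (eps x * (y : nat)%:R - 1)]].

(* Main.v *)
(* Since l - 1 divides e, the factor x ^ e is 1 in F_l, so H is the group of
   the x with eps x = 1 mod lambda. If Gamma_H is all of Gamma_0(N l), every
   value zeta of eps is congruent to 1 modulo lambda; were some zeta not 1, the
   relation 0 = 1 + zeta + ... + zeta ^ (phi(N) - 1) = phi(N) mod lambda would
   force l to divide phi(N). Hence H is everything iff eps is trivial, which
   amounts to f being on Gamma_0(N). *)

Require Import Defs.
From HB Require Import structures.
From mathcomp Require Import all_boot all_order all_algebra all_field.
From mathcomp Require Import cyclic complex.
From mathcomp Require Import all_classical all_reals all_analysis.
Local Open Scope classical_set_scope.
Local Open Scope ring_scope.

Import Order.TTheory GRing.Theory Num.Theory.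

(** A Bézout relation [u * d + v * n = 1] is the determinant of the matrix with rows [(u, -v)] and
    [(n, d)]. *)
Lemma exists_Gamma0 (n : nat) (d : int) :
  (0 < n)%N -> coprimez d n%:Z ->
  exists2 g : 'M[int]_2, Gamma0 n g & g 1 1 = d.
Proof.
move=> n_gt0 co_dn; have /coprimezP[[u v] /= uv1] := co_dn.
exists (mat2 u (- v) n%:Z d); last by rewrite mxE.
split; rewrite /SL2Z /= ?mxE //=.
- by rewrite (expand_det_row _ 0) !big_ord_recl big_ord0 /cofactor !det_mx11 !mxE /=
    addr0 expr0 expr1 mul1r mulN1r mulrNN.
- split; last by rewrite /coprimez gcdz_modl.
  by rewrite modz_ge0 ?ltz_pmod // -lt0n.
Qed.

Lemma Gamma0_coprime (n : nat) (g : 'M[int]_2) :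
  Gamma0 n g -> coprimez (g 1 1) n%:Z.
Proof. by case=> _ _ [_]; rewrite /coprimez gcdz_modl. Qed.

(** Fermat's little theorem; writing [e] as [p.-1 * q] with [q] an integer also covers negative
    exponents. *)
Lemma Fp_exprz_dvd (p : nat) (x : int) (e : int) :
  prime p -> coprimez x p%:Z -> (p.-1%:Z %| e)%Z -> (x%:~R : 'F_p) ^ e = 1.
Proof.
move=> p_prime /coprimezP[[u v] /= uv1] /dvdzP[q ->].
have x_neq0 : (x%:~R : 'F_p) != 0.
  apply/eqP => x0; have /eqP := congr1 (intr : int -> 'F_p) uv1.
  by rewrite rmorphD !rmorphM /= x0 -pmulrn pchar_Fp_0 // !mulr0 addr0 eq_sym oner_eq0.
rewrite mulrC -exprz_exp -exprnP.
suff -> : (x%:~R : 'F_p) ^+ p.-1 = 1 by rewrite exp1rz.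
apply: (mulfI x_neq0); rewrite mulr1 -exprS prednK ?prime_gt0 //.
by have := expf_card (x%:~R : 'F_p); rewrite card_Fp.
Qed.

Lemma dirichlet_characterX (R : realType) (N : nat) (eps : int -> Cx R) x n :
  dirichlet_character N eps -> eps (x ^+ n) = eps x ^+ n.
Proof.
by case=> eps1 epsM _ _; elim: n => // n IHn; rewrite !exprS epsM IHn.
Qed.

(** Euler's theorem, applied to the natural number that represents [x] modulo [N], on which [eps]
    takes the same value. *)
Lemma dirichlet_character_totient (R : realType) (N : nat) (eps : int -> Cx R) x :
  (0 < N)%N -> dirichlet_character N eps -> coprimez x N%:Z ->
  eps x ^+ totient N = 1.
Proof.
move=> N_gt0 eps_char co_xN; case: (eps_char) => eps1 _ epsP _.
have [a ax] : exists a : nat, (x %% N%:Z)%Z = a.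
  by exists `|(x %% N%:Z)%Z|%N; rewrite gez0_abs // modz_ge0 // -lt0n.
have co_aN : coprime a N by rewrite -[coprime _ _]/(coprimez a N) -ax /coprimez gcdz_modl.
rewrite (epsP x a) -?ax ?modz_mod // ax -(dirichlet_characterX _ _ _ _ _ eps_char) -eps1.
apply: epsP; rewrite -[a%:Z]natz -natrX.
by rewrite natz -[1]/(1%N%:Z) !modz_nat Euler_exp_totient.
Qed.

Section PrimeOver.
Variables (F : fieldType) (O P : set F) (p : nat).
Hypotheses (P_over : prime_over O P p) (O0 : O 0).

Lemma prime_over0 : P 0.
Proof. by case: P_over => -[_ Pp] _ PM _ _; rewrite -(mul0r p%:R); apply: PM. Qed.

Lemma prime_over_mulrn x n : P x -> P (x *+ n).
Proof.
case: P_over => _ PD _ _ _ Px; elim: n => [|n IHn]; first exact: prime_over0.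
by rewrite mulrS; apply: PD.
Qed.

Lemma prime_over_sum n (G : nat -> F) :
  (forall j, P (G j)) -> P (\sum_(j < n) G j).
Proof.
case: P_over => _ PD _ _ _ PG.
by apply: (big_ind P) => //; exact: prime_over0.
Qed.

(** Otherwise a Bézout relation would put 1 in [P]. With natural coefficients it reads
    [u * p = v * n + 1], so 1 is a sum of copies of [p] and of [- n]; the sign in the statement lets
    closure of [P] under addition suffice. *)
Lemma prime_over_natrN n : prime p -> P (- n%:R) -> (p %| n)%N.
Proof.
move=> p_prime Pn; case: P_over => -[_ Pp] PD _ P1 _.
apply/idPn; rewrite -prime_coprime // => /eqP co_pn.
have [u v uv1 _] := egcdnP n (prime_gt0 p_prime).
apply: P1; have -> : 1 = p%:R *+ u + (- n%:R) *+ v :> F.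
  by rewrite mulNrn -!mulrnA mulnC uv1 co_pn [(n * v)%N]mulnC natrD addrC addKr.
by apply: PD; apply: prime_over_mulrn.
Qed.

(* Assuming the congruence for all powers avoids asking that zeta lie in O. *)
Lemma root_of_unity_eq1 (zeta : F) n :
  prime p -> ~~ (p %| n)%N -> zeta ^+ n = 1 ->
  (forall j, P (zeta ^+ j - 1)) -> zeta = 1.
Proof.
move=> p_prime p_n zn1 Pz; apply/eqP; rewrite -subr_eq0; apply: contraNT p_n => z1.
apply: prime_over_natrN => //.
have /eqP : (zeta - 1) * \sum_(j < n) zeta ^+ j = 0 by rewrite -subrX1 zn1 subrr.
rewrite mulf_eq0 (negPf z1) /= => /eqP s0.
(* Subtracting 1 from each of the [n] terms of the vanishing geometric sum leaves [- n], which
   therefore lies in [P]. *)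
have := prime_over_sum n _ Pz.
by rewrite sumrB s0 sub0r sumr_const card_ord.
Qed.

End PrimeOver.

Lemma integers_of_coef_field0 (R : realType) (f : Cx R -> Cx R) :
  integers_of (coef_field f) 0.
Proof.
split; last exact: mxpoly.integral0.
by move=> S [S1 SB _] _; rewrite -(subrr 1) SB.
Qed.

(** At a point where [f] does not vanish, invariance under a matrix with lower right entry [x]
    forces [eps x = 1]. Conversely, holomorphy and the condition at the cusps do not involve the
    group. *)
Lemma nebentypus_trivialP (R : realType) (N k : nat) (f : Cx R -> Cx R)
    (eps : int -> Cx R) :
  (0 < N)%N -> normalized_eigenform N k f -> nebentypus N k f eps ->
  cusp_form k (Gamma0 N) f <-> forall x, coprimez x N%:Z -> eps x = 1.
Proof.
move=> N_gt0 [[f_hol _ f_cusp] [z z_uhp fz] _ _ _] [_ f_eps]; split.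
  move=> [_ f_inv _] x /(exists_Gamma0 _ _ N_gt0)[g Gg <-].
  apply: (mulIf fz); rewrite mul1r -f_eps //; exact: f_inv.
move=> eps1; split=> // g Gg w w_uhp.
by rewrite f_eps // eps1 ?mul1r //; exact: Gamma0_coprime.
Qed.

(** Chinese remainders, with the residue 1 prescribed modulo [n]. This carries classes modulo [N],
    where [eps] lives, to classes modulo [N * l], where [H] lives. *)
Lemma coprime_lift (m n : nat) (x : int) :
  coprime m n -> coprimez x m%:Z ->
  exists y : int, (x = y %[mod m%:Z])%Z /\ coprimez y (m * n)%N%:Z.
Proof.
move=> co_mn co_xm; have co_mn' : coprimez m%:Z n%:Z by [].
exists (zchinese m n x 1); split; first by rewrite zchinese_modl.
rewrite PoszM coprimezMr; apply/andP; split.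
  by rewrite /coprimez -gcdz_modl zchinese_modl // gcdz_modl.
by rewrite /coprimez -gcdz_modl zchinese_modr // gcdz_modl gcd1z.
Qed.

(** The group determines [H], since every unit class is the lower right entry of some matrix of
    [Gamma0 n]. *)
Lemma GammaH_eq_Gamma0 (n : nat) (H : set int) :
  (0 < n)%N -> H `<=` unit_residues n ->
  GammaH n H = Gamma0 n <-> forall x, coprimez x n%:Z -> H (x %% n%:Z)%Z.
Proof.
move=> n_gt0 sub_H; split.
  by move=> eqH x /(exists_Gamma0 _ _ n_gt0)[g]; rewrite -eqH => -[_ _ Hg] <-.
move=> allH; apply/seteqP; split=> g [g_SL g_n Hg]; split=> //.
  exact: sub_H.
by apply/allH/Gamma0_coprime.
Qed.

Theorem theorem5p5 (R : realType) (l N k : nat)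
  (l_prime : prime l) (l_ge5 : (5 <= l)%N)
  (N_gt0 : (0 < N)%N) (N_l : coprime N l) (k_gt2 : (2 < k)%N)
  (Fbar : closedFieldType) (emb : {rmorphism 'F_l -> Fbar})
  (Fbar_alg : forall x : Fbar, algebraicOver emb x)
  (f : Cx R -> Cx R) (eps : int -> Cx R)
  (f_eigen : normalized_eigenform N k f) (f_eps : nebentypus N k f eps)
  (lambda : set (Cx R))
  (lambda_l : prime_over (integers_of (coef_field f)) lambda l)
  (r : Cx R -> Fbar) (rho : GalQ -> 'M[Fbar]_2)
  (f_rho : attached_rep N k l f eps lambda r rho)
  (rho_irr : irreducible_rep rho)
  (i : nat) (i_le : (i <= l.-1)%N) :
  let e : int := k%:Z - 2 - 2 * i%:Z in
  let Gamma_H := GammaH (N * l) (character_kernel N l eps lambda e) in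
  (exists (f2 : Cx R -> Cx R) (eps2 : int -> Cx R) (lambda2 : set (Cx R))
          (r2 : Cx R -> Fbar) (rho2 : GalQ -> 'M[Fbar]_2),
     [/\ normalized_eigenform (N * l) 2 f2 /\ cusp_form 2 Gamma_H f2,
         nebentypus (N * l) 2 f2 eps2,
         prime_over (integers_of (coef_field f2)) lambda2 l,
         attached_rep (N * l) 2 l f2 eps2 lambda2 r2 rho2
       & iso_rep rho (twist emb i rho2)]) ->
  ~~ (l %| totient N)%N ->
  (l.-1%:Z %| e)%Z ->
  Gamma_H = Gamma0 (N * l) <-> cusp_form k (Gamma0 N) f.
Proof.
move=> e Gamma_H _ l_totient e_dvd.
have [eps_char _] := f_eps; case: (eps_char) => _ _ epsP _.
have O0 := integers_of_coef_field0 _ f.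
have Nl_gt1 : (1 < N * l)%N by rewrite (leq_trans (prime_gt1 l_prime)) ?leq_pmull.
have HP x : character_kernel N l eps lambda e x <->
    unit_residues (N * l) x /\ lambda (eps x - 1).
  have co_Nl : coprimez x (N * l)%N -> x%:~R ^ e = 1 :> 'F_l.
    by rewrite PoszM coprimezMr => /andP[_ co_xl]; apply: Fp_exprz_dvd.
  split=> [[/andP[x_gt0 x_lt] co_x] | [[/andP[x_ge0 x_lt] co_x] Px]].
    by rewrite /= co_Nl // mulr1; split=> //; split=> //; rewrite ltW.
  split=> //; last by rewrite /= co_Nl // mulr1.
  (* [character_kernel] asks for [0 < x], [unit_residues] only for [0 <= x]; the residue 0 is
     excluded because it is not prime to [N * l > 1]. *)
  rewrite x_lt andbT lt_neqAle x_ge0 andbT.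
  by apply: contraTneq co_x => <-; rewrite /coprimez gcd0z absz_nat eqz_nat gtn_eqF.
rewrite GammaH_eq_Gamma0 ?(ltnW Nl_gt1) //; last by move=> x /HP[].
rewrite (nebentypus_trivialP _ _ _ _ _ N_gt0 f_eigen f_eps).
split=> [allH x co_x | eps1 x co_x].
  have lambda_eps y : coprimez y N%:Z -> lambda (eps y - 1).
    move=> /(coprime_lift _ _ _ N_l)[y' [eq_yy' co_y']].
    have [_] := (HP _).1 (allH _ co_y').
    rewrite (epsP y ((y' %% (N * l)%N)%Z)) //.
    (* Reducing [y'] modulo [N * l] changes it by a multiple of [N]. *)
    rewrite eq_yy'; apply/eqP; rewrite eqz_mod_dvd {1}(divz_eq y' (N * l)%N) addrK.
    by rewrite PoszM mulrCA dvdz_mulr.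
  apply: (root_of_unity_eq1 _ _ _ _ lambda_l O0 _ _ l_prime l_totient).
    exact: dirichlet_character_totient.
  (* Powers of [eps x] are again values of [eps], so [lambda_eps] gives the congruence for all of
     them. *)
  move=> j; rewrite -(dirichlet_characterX _ _ _ _ _ eps_char).
  by apply/lambda_eps/coprimezXl.
have co_r : coprimez (x %% (N * l)%N)%Z (N * l)%N by rewrite /coprimez gcdz_modl.
apply/HP; split.
  by split=> //; rewrite modz_ge0 ?ltz_pmod // ?eqz_nat -?lt0n; apply: ltnW.
rewrite eps1 ?subrr; first exact: prime_over0 lambda_l O0.
by move: co_r; rewrite PoszM coprimezMr => /andP[].
Qed.
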